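(* Let $N\ge2$. For $n\ge 3$, the graph-coloring subshift $\mathcal{C}_n\subseteq\{0,\ldots,n-1\}^{\mathrm{BS}(1,N)}$ satisfies $$\log(n-2)\le h_{\mathrm{top}}(\mathcal{C}_n)\le\log(n-1).$$ Moreover $h_{\mathrm{top}}(\mathcal{C}_3)>0$. In fact: (1) if $N$ is odd then $h_{\mathrm{top}}(\mathcal{C}_3)\ge\frac12\log 2$; and (2) if $N$ is even then $h_{\mathrm{top}}(\mathcal{C}_3)\ge\frac{1}{2(N^2+1)}\log 2$.
   Context: $\mathrm{BS}(1,N)=\langle a,b\mid bab^{-1}=a^N\rangle$. For $n\ge2$, the graph-coloring subshift is $$\mathcal{C}_n=\{x\in\{0,\ldots,n-1\}^{\mathrm{BS}(1,N)} : x_g\ne x_{gs}\text{ for all } g\in \mathrm{BS}(1,N),\ s\in\{a,b\}\},$$ i.e. the set of proper $n$-colorings of the right Cayley graph of $\mathrm{BS}(1,N)$ with respect to $\{a,b\}$. The shift action on $\mathcal{A}^{\Lambda}$ (for a group $\Lambda$, $\mathcal{A}$ finite) is $\sigma_g(x)_h=x_{g^{-1}h}$, and a $\Lambda$-subshift is a closed $\sigma$-invariant subset. For a countable amenable group $\Lambda$ and a $\Lambda$-subshift $X$, the topological entropy is $$h_{\mathrm{top}}(X)=\lim_{m\to\infty}\frac{\log|\mathcal{L}_{F_m}(X)|}{|F_m|},\qquad \mathcal{L}_{F}(X)=\{x|_{F}: x\in X\},$$ where $(F_m)$ is a F\o lner sequence of finite non-empty subsets of $\Lambda$, meaning $|F_mg\,\triangle\,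 F_m|/|F_m|\to0$ for every $g\in\Lambda$; the limit exists and does not depend on the choice of $(F_m)$. For $\Lambda=\mathrm{BS}(1,N)$ one uses the sequence of rectangles $R_m=\{a^kb^i: 0\le k<N^m,\ 0\le i<m\}$, $m\ge1$. $\log$ is the natural logarithm, with $\log 1=0$. *)

(* Defs.v *)
From HB Require Import structures.
From mathcomp Require Import all_boot all_order all_algebra finmap.
From mathcomp Require Import generic_quotient.
From mathcomp Require Import all_classical all_reals all_analysis.
Set Implicit Arguments.
Unset Strict Implicit.
Unset Printing Implicit Defensive.
Import Order.TTheory GRing.Theory Num.Theory.
Import numFieldNormedType.Exports.

Local Open Scope quotient_scope.
Local Open Scope classical_set_scope.
Local Open Scope fset_scope.
Local Open Scope ring_scope.

(* Groups given by generators and relations. A letter [(i, false)] stands for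
   the generator [i] and [(i, true)] for its inverse; [(u, v) \in rels] stands
   for the relation [u = v]. *)
Definition word (I : Type) : Type := seq (I * bool).

Definition winv {I : Type} (w : word I) : word I :=
  rev [seq (l.1, ~~ l.2) | l <- w].

Inductive word_eq (I : choiceType) (rels : seq (word I * word I)) :
    word I -> word I -> Prop :=
| WRel u v : (u, v) \in rels -> word_eq rels u v
| WCancel i e : word_eq rels [:: (i, e); (i, ~~ e)] [::]
| WRefl u : word_eq rels u u
| WSym u v : word_eq rels u v -> word_eq rels v u
| WTrans u v w : word_eq rels u v -> word_eq rels v w -> word_eq rels u w
| WCat u u' v v' :
    word_eq rels u u' -> word_eq rels v v' -> word_eq rels (u ++ v) (u' ++ v').

Definition word_eqb (I : choiceType) (rels : seq (word I * word I)) :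
  rel (seq (I * bool)) := fun u v => `[< word_eq rels u v >].

Lemma word_eqb_equiv (I : choiceType) (rels : seq (word I * word I)) :
  equiv_class_of (word_eqb rels).
Proof.
split=> [u|u v|v u w].
- exact/asboolP/WRefl.
- by apply/asboolP/asboolP; apply: WSym.
- by move=> /asboolP uv /asboolP vw; apply/asboolP; apply: WTrans uv vw.
Qed.

Canonical word_eq_equiv (I : choiceType) (rels : seq (word I * word I)) :=
  EquivRelPack (word_eqb_equiv rels).

Definition presented (I : choiceType) (rels : seq (word I * word I)) : Type :=
  {eq_quot (word_eq_equiv rels)}.

HB.instance Definition _ (I : choiceType) (rels : seq (word I * word I)) :=
  Choice.on (presented rels).

Section PresentedGroup.
Context {I : choiceType} (rels : seq (word I * word I)).
Implicit Types (u v w : word I) (x y z : presented rels).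

Definition pres_class w : presented rels :=
  \pi_{eq_quot (word_eq_equiv rels)} w.

Definition pres_repr x : word I :=
  @repr _ {eq_quot (word_eq_equiv rels)} x.

Lemma pres_classP u v : pres_class u = pres_class v <-> word_eq rels u v.
Proof.
rewrite /pres_class; split=> [/eqmodP/asboolP //|uv].
exact/eqmodP/asboolP.
Qed.

Lemma pres_reprK x : pres_class (pres_repr x) = x.
Proof. exact: reprK. Qed.

Definition pres_one : presented rels := pres_class [::].
Definition pres_mul x y : presented rels :=
  pres_class (pres_repr x ++ pres_repr y).
Definition pres_inv x : presented rels := pres_class (winv (pres_repr x)).

Lemma pres_classM u v :
  pres_mul (pres_class u) (pres_class v) = pres_class (u ++ v).
Proof. by apply/pres_classP/WCat; apply/pres_classP; rewrite pres_reprK. Qed.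

Lemma winv_right w : word_eq rels (w ++ winv w) [::].
Proof.
elim: w => [|[i e] w IH]; first exact: WRefl.
have -> : winv ((i, e) :: w) = winv w ++ [:: (i, ~~ e)].
  by rewrite /winv /= rev_cons cats1.
have IHr : word_eq rels ((w ++ winv w) ++ [:: (i, ~~ e)]) [:: (i, ~~ e)].
  by rewrite -[X in word_eq _ _ X]cat0s; apply: WCat IH (WRefl _ _).
apply: WTrans (WCancel _ i e); rewrite -cat1s -catA [w ++ _]catA.
exact: (WCat (WRefl _ [:: (i, e)]) IHr).
Qed.

Lemma winvK : involutive (@winv I).
Proof.
move=> w; rewrite /winv map_rev revK -map_comp -[RHS]map_id.
by apply: eq_map => -[i e] /=; rewrite negbK.
Qed.

Lemma winv_left w : word_eq rels (winv w ++ w) [::].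
Proof. by rewrite -{2}(winvK w); apply: winv_right. Qed.

Lemma pres_mulA : associative pres_mul.
Proof.
move=> x y z; rewrite -(pres_reprK x) -(pres_reprK y) -(pres_reprK z).
by rewrite !pres_classM catA.
Qed.

Lemma pres_mul1 : left_id pres_one pres_mul.
Proof. by move=> x; rewrite -(pres_reprK x) pres_classM. Qed.

Lemma pres_mulr1 : right_id pres_one pres_mul.
Proof. by move=> x; rewrite -(pres_reprK x) pres_classM cats0. Qed.

Lemma pres_mulV : left_inverse pres_one pres_inv pres_mul.
Proof.
by move=> x; rewrite -{2}(pres_reprK x) pres_classM; apply/pres_classP/winv_left.
Qed.

Lemma pres_mulrV : right_inverse pres_one pres_inv pres_mul.
Proof.
by move=> x; rewrite -{1}(pres_reprK x) pres_classM; apply/pres_classP/winv_right.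
Qed.

HB.instance Definition _ := isGroup.Build (presented rels)
  pres_mulA pres_mul1 pres_mulr1 pres_mulV pres_mulrV.

Definition pres_gen (i : I) : presented rels := pres_class [:: (i, false)].

End PresentedGroup.

(* BS(1,N) = < a, b | b a b^-1 = a^N >; the generator [false] is a and the
   generator [true] is b. *)
Definition BS_rels (N : nat) : seq (word bool * word bool) :=
  [:: ([:: (true, false); (false, false); (true, true)],
       nseq N (false, false))].

Definition BS (N : nat) : groupType := presented (BS_rels N).
Definition BSa (N : nat) : BS N := pres_gen (BS_rels N) false.
Definition BSb (N : nat) : BS N := pres_gen (BS_rels N) true.

Lemma BS_relation (N : nat) :
  (BSb N * BSa N * (BSb N)^-1 = BSa N ^+ N)%g.
Proof.
have genX n : (BSa N ^+ n)%g = pres_class (BS_rels N) (nseq n (false, false)).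
  by elim: n => [//|n IH]; rewrite expgS IH; apply: pres_classM.
have -> : (BSb N)^-1%g = pres_class (BS_rels N) [:: (true, true)].
  apply/esym/(mulgI (BSb N)); rewrite mulgV.
  by rewrite [LHS]pres_classM; apply/pres_classP/WCancel.
rewrite genX [X in (X * _)%g]pres_classM [LHS]pres_classM.
by apply/pres_classP/WRel; rewrite mem_head.
Qed.

Definition fset_translate (G : groupType) (F : {fset G}) (g : G) : {fset G} :=
  [fset (h * g)%g | h in F].

Definition folner (R : realType) (G : groupType) (F : nat -> {fset G}) : Prop :=
  (forall m, F m != fset0) /\
  forall g : G,
    (fun m => #|` (fset_translate (F m) g `\` F m) `|`
                  (F m `\` fset_translate (F m) g)|%:R / #|` F m|%:R : R)
      @ \oo --> (0 : R).

Definition patterns (G : groupType) (A : finType) (X : set (G -> A))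
    (F : {fset G}) : {set {ffun F -> A}} :=
  finset (fun p : {ffun F -> A} =>
    `[< exists2 x, X x & forall g : F, p g = x (val g) >]).

(* The common limit along all Folner sequences (0 if there is none). *)
Definition htop (R : realType) (G : groupType) (A : finType)
    (X : set (G -> A)) : R :=
  xget 0 [set h : R | forall F : nat -> {fset G}, folner R F ->
    (fun m => ln (#|patterns X (F m)|%:R : R) / #|` F m|%:R) @ \oo --> h].

Definition graph_coloring (N n : nat) : set (BS N -> 'I_n) :=
  [set x | forall g : BS N,
     x g <> x (g * BSa N)%g /\ x g <> x (g * BSb N)%g].
Arguments graph_coloring : clear implicits.

(* Main.v *)
Require Import Defs.
From mathcomp Require Import all_boot all_order all_algebra finmap.
From mathcomp Require Import all_classical all_reals all_analysis.
From mathcomp Require Import zify ring.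
Import Order.TTheory GRing.Theory Num.Theory.
Import numFieldNormedType.Exports.

Set Implicit Arguments.
Unset Strict Implicit.
Unset Printing Implicit Defensive.

Local Open Scope ring_scope.

(** Entropy is an infimum. For a shift-invariant [X] write [rate X F] for
    [ln |L_F(X)| / |F|]. Given finite non-empty [F] and [K], the translates
    [c F] with [c] in [K F^-1] cover every point of [K] exactly [|F|] times, so
    Shearer's inequality, in its counting form ([shearer]), gives
    [|L_K|^|F| <= |L_F|^|K F^-1|] ([card_patterns_shearer]). Along a Foelner
    sequence [K_m] the ratio [|K_m F^-1| / |K_m|] tends to 1, hence the rates
    converge to their infimum over all finite non-empty sets, whatever the
    sequence ([folner_rate_cvg], [htopE]). The rectangles [a^k b^i], with
    [0 <= k < N^m] and [0 <= i < m], do form such a sequence ([folner_rect]).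
    An upper bound for the entropy therefore needs a single finite set, and a
    lower bound needs either all finite sets or the rectangles.

    The group acts on [K * int], for every commutative ring [K] in which [N] is
    invertible, by [(x, t) a = (x + N^t, t)] and [(x, t) b = (x, t + 1)]; the
    orbit map is called [coord]. For [K = rat] it separates the points of a
    rectangle, and for finite [K] it maps the Cayley graph onto a finite graph,
    whose colourings can be pulled back.

    - Upper bound [ln (n - 1)]: on the segment [1, a, .., a^M] a proper
      colouring is a walk without repetition ([htop_coloring_le]).
    - Lower bound [ln (n - 2)]: for [K = rat] colour layer [t = 0], then layers
      [1, 2, ..] and [-1, -2, ..], and every line [x + N^t Z] of a layer
      outwards from its representative in [[0, N^t)]. Each site then has at most
      two neighbours coloured before it, so [n - 2] colours remain, and the
      choices made inside a rectangle can be read off from the colouring of that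
      rectangle ([card_patterns_rect]).
    - Three colours: a site with non-zero colour all of whose neighbours have
      colour 0 can be given either of the two other colours, independently of
      all similar sites ([card_patterns_flexible]). If a family of [p] proper
      colourings makes every group element flexible at least once, the entropy
      is at least [ln 2 / p] ([htop_flexible]). For odd [N] the Cayley graph is
      bipartite and [p = 2]. For even [N] the ring [Z/(N^2 + 1)] maps it onto
      the generalised Petersen graph [G(N^2 + 1, N)], since [N^2 = -1] there; an
      explicit 3-colouring of that graph has a flexible vertex, and its
      [2 (N^2 + 1)] translates form the family. *)

(** * A counting form of Shearer's inequality *)

(** The generalised Hoelder inequality with equal exponents: once every family
    [P i] is rescaled to total mass 1, it is AM-GM applied to each [a]. *)
Lemma prod_sum_holder (R : realType) (I A : finType) (E : {set I})
    (n : A -> R) (P : I -> A -> R) (C : R) :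
  (0 < #|E|)%N -> 0 <= C -> (forall a, 0 <= n a) ->
  (forall i a, 0 <= P i a) ->
  (forall a, n a ^+ #|E| <= C * \prod_(i in E) P i a) ->
  (\sum_a n a) ^+ #|E| <= C * \prod_(i in E) \sum_a P i a.
Proof.
move=> E0 C0 n0 P0 nP; set d := #|E| in E0 nP *.
pose W i := \sum_a P i a.
have W0 i : 0 <= W i by apply: sumr_ge0.
have [[i iE Wi]|Wpos] := pselect (exists2 i, i \in E & W i = 0).
  have P_0 a : P i a = 0.
    move: Wi => /eqP; rewrite psumr_eq0// => /allP/(_ a).
    by rewrite mem_index_enum => /(_ isT)/eqP.
  have n_0 a : n a = 0.
    have := nP a; rewrite (bigD1 i)//= P_0 mul0r mulr0 => nle.
    have /eqP : n a ^+ d = 0 by apply/le_anti; rewrite nle exprn_ge0.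
    by rewrite expf_eq0 E0 => /eqP.
  rewrite big1 => [|a _]; last exact: n_0.
  by rewrite expr0n gtn_eqF// mulr_ge0// prodr_ge0// => j _; exact: W0.
have {}Wpos i : i \in E -> 0 < W i.
  by move=> iE; rewrite lt_def W0 andbT; apply/eqP => Wi; apply: Wpos; exists i.
pose D := C * \prod_(i in E) W i.
have D0 : 0 <= D by rewrite mulr_ge0// prodr_ge0.
(* [r] is the bound on [\sum_a n a] itself; AM-GM bounds [n a] by its share *)
pose r := D `^ d%:R^-1.
have r0 : 0 <= r by exact: powR_ge0.
have rd : r ^+ d = D.
  by rewrite -powR_mulrn// /r -powRrM mulVf ?powRr1// pnatr_eq0 -lt0n.
have nle a : n a <= r * ((\sum_(i in E) P i a / W i) / d%:R).
  have s0 : 0 <= (\sum_(i in E) P i a / W i) / d%:R.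
    by rewrite divr_ge0// sumr_ge0// => i _; rewrite divr_ge0.
  rewrite -(@ler_pXn2r _ d) ?nnegrE ?(mulr_ge0 r0 s0)//.
  rewrite exprMn rd; apply: (le_trans (nP a)).
  have -> : C * \prod_(i in E) P i a = D * \prod_(i in E) (P i a / W i).
    rewrite /D -mulrA -big_split/=; congr (_ * _); apply: eq_bigr => i iE.
    by rewrite mulrC divfK// gt_eqF// Wpos.
  apply: ler_wpM2l => //; apply: leif_le.
  have := @leif_AGM _ _ E (fun i => P i a / W i).
  by apply => i _; rewrite divr_ge0.
rewrite -[leRHS]/D -rd lerXn2r ?nnegrE ?sumr_ge0//.
apply: le_trans (ler_sum _ (fun a _ => nle a)) _.
rewrite -mulr_sumr -mulr_suml exchange_big/=.
rewrite (eq_bigr (fun=> 1)) => [|i iE].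
  by rewrite sumr_const -/d divff ?mulr1// pnatr_eq0 -lt0n.
by rewrite -mulr_suml divff// gt_eqF// Wpos.
Qed.

(** The value [None] outside [J] keeps all restrictions in one type. *)
Definition restrict (K A : finType) (J : {set K}) (x : {ffun K -> A}) :
    {ffun K -> option A} :=
  [ffun k => if k \in J then Some (x k) else None].

(** Induction on the set [U] of coordinates that may still vary. Fixing the
    value of one coordinate [e] cuts [S] into slices. Their restrictions to
    [J i] partition the restriction of [S] if [e \in J i], and are contained in
    it otherwise; as [e] lies in exactly [d] of the sets [J i], Hoelder's
    inequality recombines the bounds for the slices. *)
Lemma shearer_on (R : realType) (K A I : finType) (J : I -> {set K}) (d : nat)
    (U : {set K}) (S : {set {ffun K -> A}}) :
  (0 < d)%N -> {in U, forall k, #|[set i | k \in J i]| = d} ->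
  {in S &, forall x y : {ffun K -> A}, forall k, k \notin U -> x k = y k} ->
  (#|S|%:R : R) ^+ d <= \prod_i #|restrict (J i) @: S|%:R.
Proof.
move=> d0; have [m] := ubnP #|U|; elim: m U S => // m IH U S.
rewrite ltnS => Um Ud Sagree.
have [->|[x0 x0S]] := set_0Vmem S.
  by rewrite cards0 expr0n gtn_eqF// prodr_ge0.
have [U0|[e eU]] := set_0Vmem U.
  have S1 : S = [set x0].
    apply/setP => x; rewrite inE; apply/idP/eqP => [xS|->//].
    by apply/ffunP => k; apply: Sagree; rewrite // U0 inE.
  by rewrite S1 cards1 expr1n big1// => i _; rewrite imset_set1 cards1.
pose E := [set i | e \in J i].
pose Sa a := [set x in S | x e == a].
have cardS : #|S|%:R = \sum_a (#|Sa a|%:R : R).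
  rewrite -natr_sum -sum1_card.
  rewrite (partition_big (fun x : {ffun K -> A} => x e) xpredT)//=.
  congr (_%:R); apply: eq_bigr => a _; rewrite -sum1_card.
  by apply: eq_bigl => x; rewrite inE.
pose W i : R := #|restrict (J i) @: S|%:R.
pose P i a : R := #|restrict (J i) @: Sa a|%:R.
have PW i a : P i a <= W i.
  rewrite ler_nat subset_leq_card// imsetS//.
  by apply/fintype.subsetP => x; rewrite inE => /andP[].
have PsumW i : i \in E -> \sum_a P i a = W i.
  rewrite inE => ei; rewrite -natr_sum /W -[in RHS]sum1_card.
  (* the default [x0 e] is never reached: [e] belongs to [J i] *)
  pose at_e (y : {ffun K -> option A}) := odflt (x0 e) (y e).
  rewrite [in RHS](partition_big at_e xpredT)//=.
  congr (_%:R); apply: eq_bigr => a _; rewrite -sum1_card; apply: eq_bigl => y.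
  apply/imsetP/andP => [[x]|[/imsetP[x xS ->]]].
    rewrite inE => /andP[xS /eqP xa] ->; split; first exact: imset_f.
    by rewrite /at_e ffunE ei/= xa.
  by rewrite /at_e ffunE ei/= => xa; exists x; rewrite // inE xS.
have Ed : #|E| = d by exact: Ud.
have step a : (#|Sa a|%:R : R) ^+ #|E| <=
    (\prod_(i | i \notin E) W i) * \prod_(i in E) P i a.
  rewrite Ed; apply: le_trans (IH (U :\ e) (Sa a) _ _ _) _.
  - by rewrite (cardsD1 e U) eU in Um.
  - by move=> k /setD1P[_ kU]; exact: Ud.
  - move=> x y; rewrite !inE => /andP[xS /eqP xa] /andP[yS /eqP ya] k.
    rewrite !inE negb_and negbK => /orP[/eqP->|]; first by rewrite xa ya.
    exact: Sagree.
  rewrite [leLHS](bigID (mem E))/= mulrC.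
  apply: ler_wpM2r; first exact: prodr_ge0.
  by apply: ler_prod => i _; rewrite PW andbT /P.
rewrite [leRHS](bigID (mem E))/= mulrC cardS -Ed.
under [X in _ <= _ * X]eq_bigr => i iE do rewrite -[_%:R]/(W i) -PsumW//.
by apply: prod_sum_holder => //; rewrite ?Ed// prodr_ge0.
Qed.

Lemma shearer (R : realType) (K A I : finType) (J : I -> {set K}) (d : nat)
    (S : {set {ffun K -> A}}) :
  (0 < d)%N -> (forall k, #|[set i | k \in J i]| = d) ->
  (#|S|%:R : R) ^+ d <= \prod_i #|restrict (J i) @: S|%:R.
Proof.
move=> d0 Jd; apply: (@shearer_on R K A I J d [set: K]) => // x y _ _ k.
by rewrite inE.
Qed.

(** * Entropy as an infimum *)

Section Entropy.
Local Open Scope classical_set_scope.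
Local Open Scope fset_scope.
Local Open Scope ring_scope.
Context (R : realType) (G : groupType) (A : finType).
Implicit Types (X : set (G -> A)) (F K : {fset G}) (Fm : nat -> {fset G}).

Definition shift_invariant X := forall (g : G) (x : G -> A),
  X x -> X (fun h => x (g * h)%g).

(** Patterns on [F] can be counted on any finite type that enumerates [F]. *)
Lemma card_patterns_image (T : finType) (e : T -> G) X F :
  (F =i codom e) ->
  #|patterns X F| = #|[set q : {ffun T -> A} |
    `[< exists2 x, X x & forall i, q i = x (e i) >]]%SET|.
Proof.
move=> Fe; have eF i : e i \in F by rewrite Fe codom_f.
pose phi (p : {ffun F -> A}) : {ffun T -> A} := [ffun i => p [` eF i]].
have phi_inj : injective phi.
  move=> p q /ffunP pq; apply/ffunP => g.
  have /codomP[i gi] : val g \in codom e by rewrite -Fe; exact: valP.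
  by have := pq i; rewrite !ffunE; congr (p _ = q _); apply: val_inj.
rewrite -(card_imset (mem (patterns X F)) phi_inj); apply: eq_card => q.
rewrite inE; apply/imsetP/asboolP => [[p]|[x Xx qx]].
  rewrite inE => /asboolP[x Xx px] ->; exists x => // i.
  by rewrite ffunE px.
exists [ffun g : F => x (val g)].
  by rewrite inE; apply/asboolP; exists x => // g; rewrite ffunE.
by apply/ffunP => i; rewrite !ffunE qx.
Qed.

(** The [c] for which the translate [c F] meets [K]. *)
Definition thicken K F : {fset G} := [fset (k * f^-1)%g | k in K, f in F].

(** The translates [c F] cover each [k] in [K] exactly [|F|] times, namely for
    [c = k f^-1] with [f] in [F], and by shift invariance none of them carries
    more patterns than [F] does. *)
Lemma card_patterns_shearer X K F : shift_invariant X -> F != fset0 ->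
  (#|patterns X K|%:R : R) ^+ #|` F| <=
  #|patterns X F|%:R ^+ #|` thicken K F|.
Proof.
move=> Xinv F0; set C := thicken K F.
pose J (c : C) : {set K} := finset (fun k : K => ((val c)^-1 * val k)%g \in F).
have covered (k : K) : #|finset (fun c : C => k \in J c)| = #|` F|.
  have inC (f : F) : (val k * (val f)^-1)%g \in C.
    apply/imfset2P; exists (val k); first exact: valP.
    by exists (val f) => //; exact: valP.
  pose psi f : C := [` inC f].
  have psi_inj : injective psi.
    by move=> f f' /(congr1 val)/= /mulgI/invg_inj/val_inj.
  rewrite cardfE -(card_imset predT psi_inj); apply: eq_card => c.
  rewrite !inE; apply/idP/imsetP => [cF|[f _ ->]].
    exists [` cF] => //; apply: val_inj => /=.
    by rewrite invgM invgK mulVKg.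
  by rewrite /= invgF mulgVK; exact: valP.
have F_gt0 : (0 < #|` F|)%N by rewrite cardfs_gt0.
apply: (le_trans (shearer R (patterns X K) F_gt0 covered)).
rewrite [in leRHS]cardfE -prodr_const; apply: ler_prod => c _.
rewrite ler0n ler_nat.
(* a pattern on [K] restricted to [c F] is the translate of a pattern on [F] *)
pose theta (q : {ffun F -> A}) : {ffun K -> option A} :=
  [ffun k : K => omap q (insub ((val c)^-1 * val k)%g)].
apply: leq_trans (leq_imset_card theta (mem (patterns X F))).
apply/subset_leq_card/fintype.subsetP => y /imsetP[p].
rewrite inE => /asboolP[x Xx px] ->.
apply/imsetP; exists [ffun f : F => x (val c * val f)%g].
  rewrite inE; apply/asboolP.
  exists (fun h => x (val c * h)%g); first exact: Xinv.
  by move=> f; rewrite ffunE.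
apply/ffunP => k; rewrite !ffunE inE; case: insubP => [f -> fE|/negbTE->//] /=.
by rewrite ffunE fE mulVKg px.
Qed.

Definition rate X F : R := ln #|patterns X F|%:R / #|` F|%:R.

Lemma ln_nat_ge0 (n : nat) : 0 <= ln (n%:R : R).
Proof. by case: n => [|n]; [rewrite ln0|rewrite ln_ge0// ler1n]. Qed.

Lemma rate_ge0 X F : 0 <= rate X F.
Proof. by rewrite divr_ge0// ln_nat_ge0. Qed.

Lemma rate_thicken X K F : shift_invariant X -> K != fset0 -> F != fset0 ->
  rate X K <= #|` thicken K F|%:R / #|` K|%:R * rate X F.
Proof.
move=> Xinv K0 F0; have := card_patterns_shearer K Xinv F0.
have Kp : 0 < #|` K|%:R :> R by rewrite ltr0n cardfs_gt0.
have Fp : 0 < #|` F|%:R :> R by rewrite ltr0n cardfs_gt0.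
have [k0|kp] := posnP #|patterns X K|.
  move=> _; rewrite [leLHS]/rate k0 ln0// mul0r.
  by rewrite mulr_ge0 ?rate_ge0// divr_ge0.
move=> le_pow.
have fp : (0 < #|patterns X F|)%N.
  rewrite lt0n; apply/eqP => f0; move: le_pow.
  rewrite f0 expr0n; have -> : (#|` thicken K F| == 0)%N = false.
    have [[k kK] [f fF]] := (fset0Pn _ K0, fset0Pn _ F0).
    apply/negbTE; rewrite -lt0n cardfs_gt0; apply/fset0Pn.
    by exists (k * f^-1)%g; apply/imfset2P; exists k => //; exists f.
  by rewrite leNgt exprn_gt0// ltr0n.
have := le_pow; rewrite -ler_ln ?posrE ?exprn_gt0 ?ltr0n//.
rewrite !lnXn ?ltr0n// => le_ln.
rewrite /rate ler_pdivrMr//.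
have -> : #|` thicken K F|%:R / #|` K|%:R * (ln #|patterns X F|%:R / #|` F|%:R)
    * #|` K|%:R = #|` thicken K F|%:R * ln #|patterns X F|%:R / #|` F|%:R :> R.
  by field; rewrite !gt_eqF.
by rewrite ler_pdivlMr// mulr_natr [leRHS]mulr_natl.
Qed.

(** Far along a Foelner sequence every term of the sum is negligible compared
    with [#|` K|]. *)
Lemma card_thicken K F :
  (#|` thicken K F| <=
   #|` K| + \sum_(f <- F) #|` fset_translate K f^-1 `\` K|)%N.
Proof.
pose s := K ++ flatten [seq enum_fset (fset_translate K f^-1%g `\` K) | f <- F].
have -> : (#|` K| + \sum_(f <- F) #|` fset_translate K f^-1%g `\` K|)%N
    = size s.
  by rewrite size_cat size_flatten sumnE /shape -map_comp big_map.
apply: uniq_leq_size; first exact: fset_uniq.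
move=> g /imfset2P[k kK [f fF ->]]; rewrite mem_cat.
have [//|gK] := boolP (k * f^-1 \in K)%g; apply/orP; right.
apply/flatten_mapP; exists f => //; rewrite in_fsetD gK /=.
by apply/imfsetP; exists k.
Qed.

Lemma folner_thicken Fm F : folner R Fm ->
  (fun m => 1 + \sum_(f <- F)
     #|` fset_translate (Fm m) f^-1 `\` Fm m|%:R / #|` Fm m|%:R : R)
    @ \oo --> (1 : R).
Proof.
move=> [Fm0 Fmg]; rewrite -[X in _ --> X]addr0.
apply: cvgD; first exact: cvg_cst.
elim: (enum_fset F) => [|f fs IH].
  under eq_fun do rewrite big_nil.
  exact: cvg_cst.
under eq_fun do rewrite big_cons.
have f_lim : (fun m => #|` fset_translate (Fm m) f^-1 `\` Fm m|%:R
                         / #|` Fm m|%:R : R) @ \oo --> (0 : R).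
  apply: (@squeeze_cvgr _ _ _ _ (fun=> 0) _ _ _ _ _ (Fmg f^-1%g)).
    near=> m; rewrite divr_ge0//= ler_pM2r ?invr_gt0 ?ltr0n ?cardfs_gt0//.
    by rewrite ler_nat fsubset_leq_card// fsubsetUl.
  exact: cvg_cst.
by have sum_lim := cvgD f_lim IH; rewrite addr0 in sum_lim; exact: sum_lim.
Unshelve. all: by end_near.
Qed.

Definition rates X : set R := [set rate X F | F in [set F | F != fset0]].

(** No rate is below the infimum, and for fixed [F] the rate of [Fm m] is
    eventually below any number above the rate of [F]. This gives the existence
    of the limit along all Foelner sequences at once, which for a general
    subadditive function requires quasi-tilings. *)
Lemma folner_rate_cvg X Fm : shift_invariant X -> folner R Fm ->
  (fun m => rate X (Fm m)) @ \oo --> inf (rates X).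
Proof.
move=> Xinv Fol; have [Fm0 _] := Fol.
have rates_lb : has_lbound (rates X).
  by exists 0 => _ [F _ <-]; exact: rate_ge0.
have rates_inf : has_inf (rates X).
  by split=> //; exists (rate X (Fm 0%N)), (Fm 0%N) => //=.
apply/cvgrPdist_lt => eps eps0.
have [_ [F /= F0 <-] rF] := inf_adherent eps0 rates_inf.
have bound_cvg : (fun m => (1 + \sum_(f <- F)
     #|` fset_translate (Fm m) f^-1 `\` Fm m|%:R / #|` Fm m|%:R) * rate X F)
    @ \oo --> 1 * rate X F.
  by apply: cvgM; [exact: folner_thicken|exact: cvg_cst].
rewrite mul1r in bound_cvg.
near=> m.
have lt_m : (1 + \sum_(f <- F) #|` fset_translate (Fm m) f^-1 `\` Fm m|%:R
    / #|` Fm m|%:R) * rate X F < inf (rates X) + eps.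
  by near: m; exact: cvgr_lt bound_cvg _ rF.
rewrite distrC ger0_norm ?subr_ge0; last first.
  by apply: ge_inf => //; exists (Fm m); rewrite /=.
rewrite ltrBlDl; apply: le_lt_trans lt_m.
apply: le_trans (rate_thicken Xinv (Fm0 m) F0) _.
rewrite ler_wpM2r ?rate_ge0//.
have Fp : 0 < #|` Fm m|%:R :> R by rewrite ltr0n cardfs_gt0.
rewrite ler_pdivrMr// mulrDl mul1r mulr_suml.
rewrite (eq_bigr (fun f => #|` fset_translate (Fm m) f^-1 `\` Fm m|%:R)).
  by rewrite -natr_sum -natrD ler_nat card_thicken.
by move=> f _; rewrite divfK// gt_eqF.
Unshelve. all: by end_near.
Qed.

Lemma htopE X : shift_invariant X -> (exists Fm, folner R Fm) ->
  htop R X = inf (rates X).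
Proof.
move=> Xinv [Fm FolF]; apply: xget_unique.
  by move=> Fm'; exact: folner_rate_cvg.
move=> h /(_ Fm FolF) h_lim; apply: cvg_unique h_lim _ => //.
exact: folner_rate_cvg.
Qed.

End Entropy.

Arguments rates R {G A} X.

(** * Coordinates on the Baumslag-Solitar group *)

Section PresentedAction.
Context (I : choiceType) (rels : seq (word I * word I)) (V : Type).
Variable act : I * bool -> V -> V.
Hypothesis act_cancel : forall i e v, act (i, ~~ e) (act (i, e) v) = v.

(** A right action: the first letter of a word acts first. *)
Definition word_act (v : V) (w : word I) : V := foldl (fun v l => act l v) v w.

Hypothesis act_rels : forall u w, (u, w) \in rels ->
  forall v, word_act v u = word_act v w.

Lemma word_act_eq u w :
  word_eq rels u w -> forall v, word_act v u = word_act v w.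
Proof.
elim=> {u w} [u w /act_rels//|i e|//|u w _ IH v|u w t _ uw _ wt v|] /=.
- by move=> v; rewrite act_cancel.
- by rewrite IH.
- by rewrite uw.
move=> u u' w w' _ uu' _ ww' v.
by rewrite /word_act !foldl_cat -!/(word_act _ _) uu' ww'.
Qed.

Definition pres_act (v : V) (g : presented rels) : V :=
  word_act v (pres_repr g).

Lemma pres_act_class v w : pres_act v (pres_class rels w) = word_act v w.
Proof. by apply: word_act_eq; apply/pres_classP; rewrite pres_reprK. Qed.

Lemma pres_actM v g h : pres_act v (g * h)%g = pres_act (pres_act v g) h.
Proof. by rewrite [LHS]pres_act_class /word_act foldl_cat. Qed.

Lemma pres_act1 v : pres_act v 1%g = v.
Proof. exact: pres_act_class. Qed.

Lemma pres_act_gen v i : pres_act v (pres_gen rels i) = act (i, false) v.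
Proof. exact: pres_act_class. Qed.

End PresentedAction.

Section Coordinates.
Context (N : nat) (K : comUnitRingType).
Hypothesis unitN : (N%:R : K) \is a GRing.unit.

(** Right multiplication by [a = (1, 0)] and [b = (0, 1)] in the semidirect
    product of [K] with the integers, where 1 acts on [K] as multiplication by
    [N]. *)
Definition affine_act (l : bool * bool) (v : K * int) : K * int :=
  match l with
  | (false, false) => (v.1 + N%:R ^ v.2, v.2)
  | (false, true) => (v.1 - N%:R ^ v.2, v.2)
  | (true, false) => (v.1, v.2 + 1)
  | (true, true) => (v.1, v.2 - 1)
  end.

Lemma affine_act_cancel i e v :
  affine_act (i, ~~ e) (affine_act (i, e) v) = v.
Proof. by case: i e v => -[] [x t]; rewrite /= ?addrK ?subrK. Qed.

Lemma affine_act_rels u w : (u, w) \in BS_rels N ->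
  forall v, word_act affine_act v u = word_act affine_act v w.
Proof.
rewrite inE => /eqP[-> ->] [x t]; rewrite /word_act /= addrK.
have nseqE n y : foldl (fun v l => affine_act l v) (y, t)
    (nseq n (false, false)) = (y + N%:R ^ t *+ n, t).
  by elim: n y => [|n IH] y /=; rewrite ?addr0// IH mulrS addrA.
by rewrite nseqE exprzDr// expr1z mulr_natr.
Qed.

Definition coord (v : K * int) (g : BS N) : K * int :=
  pres_act (rels := BS_rels N) affine_act v g.

Lemma coordM v g h : coord v (g * h)%g = coord (coord v g) h.
Proof. exact: (pres_actM affine_act_cancel affine_act_rels). Qed.

Lemma coord1 v : coord v 1%g = v.
Proof. exact: (pres_act1 affine_act_cancel affine_act_rels). Qed.

Lemma coord_a v : coord v (BSa N) = (v.1 + N%:R ^ v.2, v.2).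
Proof. exact: (pres_act_gen affine_act_cancel affine_act_rels). Qed.

Lemma coord_b v : coord v (BSb N) = (v.1, v.2 + 1).
Proof. exact: (pres_act_gen affine_act_cancel affine_act_rels). Qed.

Lemma coord_aV v : coord v (BSa N)^-1 = (v.1 - N%:R ^ v.2, v.2).
Proof.
have := coordM (v.1 - N%:R ^ v.2, v.2) (BSa N) (BSa N)^-1.
by rewrite mulgV coord1 coord_a /= subrK -surjective_pairing => ->.
Qed.

Lemma coord_bV v : coord v (BSb N)^-1 = (v.1, v.2 - 1).
Proof.
have := coordM (v.1, v.2 - 1) (BSb N) (BSb N)^-1.
by rewrite mulgV coord1 coord_b /= subrK -surjective_pairing => ->.
Qed.

(** Moving the base point is a left translation, so one colouring of [K * int]
    yields all its translates. *)
Lemma coord_base v g : coord v g =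
  (v.1 + N%:R ^ v.2 * (coord (0, 0) g).1, v.2 + (coord (0, 0) g).2).
Proof.
case: v => x t /=; rewrite /coord /pres_act.
elim/last_ind: (pres_repr g) => [|w l IH].
  by rewrite /= mulr0 !addr0.
rewrite /word_act !foldl_rcons -!/(word_act _ _ _) IH.
case: (word_act _ (0, 0) w) => y s; case: l => -[] [] /=.
- by rewrite addrA.
- by rewrite addrA.
- by rewrite exprzDr// mulrBr addrA.
- by rewrite exprzDr// mulrDr addrA.
Qed.

Lemma coord_aX k v : coord v (BSa N ^+ k) = (v.1 + N%:R ^ v.2 *+ k, v.2).
Proof.
elim: k v => [|k IH] v; first by rewrite coord1 addr0 -surjective_pairing.
by rewrite expgS coordM coord_a IH /= mulrS addrA.
Qed.

Lemma coord_bX i v : coord v (BSb N ^+ i) = (v.1, v.2 + i%:Z).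
Proof.
elim: i v => [|i IH] v; first by rewrite coord1 addr0 -surjective_pairing.
by rewrite expgS coordM coord_b IH /= -addrA -intS.
Qed.

End Coordinates.

Definition box (N : nat) (k i : nat) : BS N := (BSa N ^+ k * BSb N ^+ i)%g.

Lemma unit_rat N : (0 < N)%N -> (N%:R : rat) \is a GRing.unit.
Proof. by move=> N0; rewrite unitfE pnatr_eq0 -lt0n. Qed.

Lemma coord_box N k i : (0 < N)%N ->
  coord (K := rat) (0, 0) (box N k i) = (k%:R, i%:Z).
Proof.
move=> N0; have uN := unit_rat N0.
by rewrite coordM// coord_aX// coord_bX//= !add0r expr0z.
Qed.

Lemma box_inj N k i k' i' : (0 < N)%N -> box N k i = box N k' i' ->
  k = k' /\ i = i'.
Proof.
move=> N0 /(congr1 (coord (K := rat) (0, 0))); rewrite !coord_box// => -[+ ->].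
by move=> /eqP; rewrite eqr_nat => /eqP.
Qed.

Lemma box_b N k i : (box N k i * BSb N)%g = box N k i.+1.
Proof. by rewrite /box -mulgA -expgSr. Qed.

Lemma box_a N k i : (box N k i * BSa N)%g = box N (k + N ^ i) i.
Proof.
rewrite /box -mulgA.
suff -> : (BSb N ^+ i * BSa N = BSa N ^+ (N ^ i) * BSb N ^+ i)%g.
  by rewrite mulgA -expgnDr.
have ba j : (BSb N * BSa N ^+ j = BSa N ^+ (N * j) * BSb N)%g.
  elim: j => [|j IH]; first by rewrite muln0 mulg1 mul1g.
  rewrite expgSr mulgA IH -mulgA mulnS addnC expgnDr -mulgA; congr (_ * _)%g.
  by rewrite -BS_relation mulgVK.
elim: i => [|i IH]; first by rewrite !mul1g mulg1.
by rewrite expgS -mulgA IH mulgA ba -mulgA -expgS expnS.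
Qed.

(** * Rectangles form a Foelner sequence *)

Section Translates.
Local Open Scope fset_scope.
Context (G : groupType).
Implicit Types (F : {fset G}) (g h : G).

Lemma fset_translateP F g h : reflect (exists2 f, f \in F & h = (f * g)%g)
  (h \in fset_translate F g).
Proof. exact: imfsetP. Qed.

Lemma card_fset_translate F g : #|` fset_translate F g| = #|` F|.
Proof. by rewrite card_imfset//; exact: mulIg. Qed.

(** Half the size of the symmetric difference of [F g] and [F], by [escapeE].
    It is subadditive in [g], so generators are all that must be estimated. *)
Definition escape F g : nat := #|` fset_translate F g `\` F|.

Lemma escapeE F g : escape F g = #|` F `\` fset_translate F g|.
Proof. by rewrite /escape !cardfsD card_fset_translate fsetIC. Qed.

Lemma escapeV F g : escape F g^-1 = escape F g.
Proof.
rewrite [RHS]escapeE /escape -(card_fset_translate (_ `\` F) g); congr #|` _|.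
apply/fsetP => h; apply/fset_translateP/idP => [[f]|].
  rewrite in_fsetD => /andP[fF /fset_translateP[k kF kf]] ->.
  rewrite in_fsetD {2}kf mulgVK kF andbT; apply: contra fF.
  by case/fset_translateP => f' f'F /mulIg ->.
rewrite in_fsetD => /andP[hFg hF]; exists (h * g^-1)%g; last by rewrite mulgVK.
rewrite in_fsetD; apply/andP; split.
  apply: contra hFg => hF'; apply/fset_translateP.
  by exists (h * g^-1)%g; rewrite // mulgVK.
by apply/fset_translateP; exists h.
Qed.

Lemma escapeM F g h : (escape F (g * h) <= escape F g + escape F h)%N.
Proof.
rewrite /escape -(card_fset_translate (fset_translate F g `\` F) h).
apply: leq_trans (leq_card_fsetU _ _).
apply: fsubset_leq_card; apply/fsubsetP => x.
rewrite in_fsetD => /andP[xF /fset_translateP[f fF xE]].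
rewrite in_fsetU; have [fgF|fgF] := boolP (f * g \in F)%g.
  apply/orP; right; rewrite in_fsetD xF; apply/fset_translateP.
  by exists (f * g)%g; rewrite // -mulgA.
apply/orP; left; apply/fset_translateP.
exists (f * g)%g; last by rewrite -mulgA.
by rewrite in_fsetD fgF; apply/fset_translateP; exists f.
Qed.

Lemma escape1 F : escape F 1 = 0%N.
Proof.
apply/eqP; rewrite cardfs_eq0; apply/eqP/fsetP => h; rewrite in_fsetD in_fset0.
apply/negbTE; rewrite negb_and negbK; have [//|hF] := boolP (h \in F).
apply/negP => /fset_translateP[f fF]; rewrite mulg1 => hf.
by rewrite hf fF in hF.
Qed.

Lemma card_symdiff_translate F g :
  (#|` (fset_translate F g `\` F) `|` (F `\` fset_translate F g)|
   <= (escape F g).*2)%N.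
Proof. by rewrite -addnn {2}escapeE; exact: leq_card_fsetU. Qed.

End Translates.

Lemma presented_ind (I : choiceType) (rels : seq (word I * word I))
    (P : presented rels -> Prop) :
  P 1%g -> (forall g h, P g -> P h -> P (g * h)%g) ->
  (forall g, P g -> P g^-1%g) -> (forall i, P (pres_gen rels i)) ->
  forall g, P g.
Proof.
move=> P1 PM PV Pgen g; rewrite -(pres_reprK g).
elim: (pres_repr g) => [//|[i e] w IH].
rewrite -cat1s -pres_classM; apply: PM => //; case: e; last exact: Pgen.
have -> : pres_class rels [:: (i, true)] = (pres_gen rels i)^-1%g.
  apply: (mulgI (pres_gen rels i)); rewrite mulgV [LHS]pres_classM.
  by apply/pres_classP/WCancel.
exact/PV/Pgen.
Qed.

Lemma card_fset_codom (T : finType) (G : choiceType) (e : T -> G)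
    (F : {fset G}) :
  injective e -> F =i codom e -> (#|` F| = #|T|)%fset.
Proof.
move=> e_inj Fe; rewrite -(size_codom e); apply/perm_size/uniq_perm => //.
by rewrite map_inj_uniq// enum_uniq.
Qed.

Section Rectangles.
Local Open Scope fset_scope.
Local Open Scope ring_scope.
Variable N : nat.
Hypothesis N_ge2 : (2 <= N)%N.
Let N_gt0 : (0 < N)%N. Proof. exact: ltnW. Qed.

Definition rect_point (m : nat) (p : 'I_(N ^ m) * 'I_m) : BS N := box N p.1 p.2.

Definition rect (m : nat) : {fset BS N} :=
  [fset rect_point p | p in [pred _ : 'I_(N ^ m) * 'I_m | true]].

Lemma rectP m g :
  reflect (exists k i, [/\ (k < N ^ m)%N, (i < m)%N & g = box N k i])
    (g \in rect m).
Proof.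
apply: (iffP (imfsetP _ _ _ _)) => [[[k i] _ ->]|[k [i [km im ->]]]].
  by exists k, i.
by exists (Ordinal km, Ordinal im).
Qed.

Lemma rect_codom m :
  rect m =i codom (@rect_point m).
Proof.
move=> g; apply/imfsetP/codomP => [[p _ ->]|[p ->]]; by exists p.
Qed.

Lemma rect_point_inj m : injective (@rect_point m).
Proof.
move=> [k i] [k' i'] /= /(box_inj N_gt0)[kk ii].
by congr (_, _); apply: val_inj.
Qed.

Lemma card_rect m : #|` rect m| = (N ^ m * m)%N.
Proof.
rewrite (card_fset_codom (@rect_point_inj m) (rect_codom m)).
by rewrite card_prod !card_ord.
Qed.

Lemma sum_pow_le m : (\sum_(i <- iota 0 m) N ^ i <= N ^ m)%N.
Proof.
elim: m => [|m IH]; first by rewrite big_nil.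
rewrite -addn1 iotaD big_cat big_seq1 add0n expnD expn1.
apply: leq_trans (leq_add IH (leqnn _)) _.
by rewrite addnn -muln2 leq_mul2l N_ge2 orbT.
Qed.

(** In row [i], multiplication by [a^-1] shifts [k] by [N ^ i], so that only the
    first [N ^ i] sites leave the rectangle. *)
Lemma escape_rect_a m : (escape (rect m) (BSa N) <= N ^ m)%N.
Proof.
rewrite -escapeV; apply: leq_trans (sum_pow_le m).
pose s := [seq (box N k i * (BSa N)^-1)%g | i <- iota 0 m, k <- iota 0 (N ^ i)].
have -> : (\sum_(i <- iota 0 m) N ^ i)%N = size s.
  rewrite size_allpairs_dep sumnE big_map; apply: eq_bigr => i _.
  by rewrite size_iota.
apply: uniq_leq_size; first exact: fset_uniq.
move=> g; rewrite in_fsetD => /andP[gF].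
move=> /fset_translateP[_ /rectP[k [i [km im ->]]] gE].
apply/allpairsPdep; exists i, k; split=> //; rewrite mem_iota//= add0n.
rewrite ltnNge; apply: contra gF => ik; apply/rectP; exists (k - N ^ i)%N, i.
split=> //; first exact: leq_ltn_trans (leq_subr _ _) km.
by rewrite gE -{1}(subnK ik) -box_a mulgK.
Qed.

Lemma escape_rect_b m : (escape (rect m) (BSb N) <= N ^ m)%N.
Proof.
rewrite -[leqRHS](size_iota 0) -(size_map (fun k => box N k m)).
apply: uniq_leq_size; first exact: fset_uniq.
move=> g; rewrite in_fsetD => /andP[gF].
move=> /fset_translateP[_ /rectP[k [i [km im ->]]] gE].
rewrite box_b in gE; have im' : i.+1 = m.
  apply/eqP; rewrite eqn_leq im leqNgt; apply: contra gF => im'.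
  by apply/rectP; exists k, i.+1.
by apply/mapP; exists k; rewrite ?mem_iota//= gE im'.
Qed.

Lemma escape_rect g : exists C, forall m, (escape (rect m) g <= C * N ^ m)%N.
Proof.
elim/presented_ind: g => [|g h [C gC] [D hD]|g [C gC]|i].
- by exists 0%N => m; rewrite escape1.
- exists (C + D)%N => m; rewrite mulnDl.
  exact: leq_trans (escapeM _ _ _) (leq_add (gC m) (hD m)).
- by exists C => m; rewrite escapeV.
- exists 1%N => m; rewrite mul1n; case: i; first exact: escape_rect_b.
  exact: escape_rect_a.
Qed.

Lemma folner_rect (R : realType) : folner R (fun m => rect m.+1).
Proof.
have cardp m : (0 < #|` rect m.+1|)%N.
  by rewrite card_rect muln_gt0 expn_gt0 N_gt0.
split=> [m|g]; first by rewrite -cardfs_gt0.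
have [C gC] := escape_rect g.
have bound_lim :
    ((fun m => (C.*2)%:R * m.+1%:R^-1 : R) @ \oo --> (0 : R))%classic.
  rewrite -(mulr0 (C.*2%:R : R)).
  by apply: cvgM; [exact: cvg_cst|exact: cvg_harmonic].
apply: (@squeeze_cvgr _ _ _ _ (fun=> 0) _ _ _ _ _ bound_lim).
  near=> m; rewrite divr_ge0//= ler_pdivrMr ?ltr0n// card_rect.
  rewrite mulrAC ler_pdivlMr// -!natrM ler_nat.
  apply: leq_trans (leq_mul (card_symdiff_translate _ _) (leqnn _)) _.
  rewrite mulnA leq_mul2r; apply/orP; right.
  by rewrite -doubleMl leq_double gC.
exact: cvg_cst.
Unshelve. all: by end_near.
Qed.

End Rectangles.

(** * Bounds on the entropy of colourings *)

Section HtopBounds.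
Context (R : realType) (N n : nat).
Hypothesis N_ge2 : (2 <= N)%N.
Let X := graph_coloring N n.

Lemma graph_coloring_shift_invariant : shift_invariant X.
Proof. by move=> g x Xx h; rewrite !mulgA; exact: Xx. Qed.

Let Xinv := graph_coloring_shift_invariant.

Lemma htop_coloringE : htop R X = inf (rates R X).
Proof.
apply: htopE => //; exists (fun m => rect N m.+1); exact: folner_rect.
Qed.

Lemma htop_le_rate F : F != fset0%fset -> htop R X <= rate R X F.
Proof.
move=> F0; rewrite htop_coloringE; apply: ge_inf; last by exists F.
by exists 0 => _ [E _ <-]; exact: rate_ge0.
Qed.

Lemma htop_ge c :
  (forall F, F != fset0%fset -> c <= rate R X F) -> c <= htop R X.
Proof.
move=> cF; rewrite htop_coloringE; apply: lb_le_inf.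
  exists (rate R X (rect N 1)), (rect N 1) => //=.
  exact: (folner_rect N_ge2 R).1 0%N.
by move=> _ [F F0 <-]; exact: cF.
Qed.

Lemma htop_ge_rect c : (forall m, c <= rate R X (rect N m.+1)) -> c <= htop R X.
Proof.
move=> cm; rewrite htop_coloringE.
apply: (cvgr_to_ge (folner_rate_cvg Xinv (folner_rect N_ge2 R))).
by near=> m; exact: cm.
Unshelve. all: by end_near.
Qed.

End HtopBounds.

(** A path is coded by its first colour and the successive differences modulo
    [p.+1], which range over the [p] non-zero residues. *)
Lemma card_proper_paths p M (S : {set {ffun 'I_M.+1 -> 'I_p.+1}}) :
  {in S, forall q : {ffun 'I_M.+1 -> 'I_p.+1},
     forall i : 'I_M, q (widen_ord (leqnSn M) i) != q (lift ord0 i)} ->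
  (#|S| <= p.+1 * p ^ M)%N.
Proof.
move=> Sproper.
pose code (q : {ffun 'I_M.+1 -> 'I_p.+1}) : 'I_p.+1 * {ffun 'I_M -> 'I_p.+1} :=
  (q ord0, [ffun i => q (lift ord0 i) - q (widen_ord (leqnSn M) i)]).
have code_inj : injective code.
  move=> q r [qr0 /ffunP qr]; apply/ffunP => -[k kM].
  elim: k kM => [|k IH] kM.
    by rewrite (_ : Ordinal kM = ord0)//; exact: val_inj.
  have kM' : (k < M)%N by [].
  have := qr (Ordinal kM'); rewrite !ffunE.
  have -> : widen_ord (leqnSn M) (Ordinal kM') = Ordinal (ltnW kM).
    exact: val_inj.
  have -> : lift ord0 (Ordinal kM') = Ordinal kM by exact: val_inj.
  by rewrite IH => /addIr.
rewrite -(card_imset (mem S) code_inj).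
pose nonzero : {set {ffun 'I_M -> 'I_p.+1}} :=
  [set f | f \in ffun_on (predC1 (0 : 'I_p.+1))]%SET.
pose T := finset.setX [set: 'I_p.+1]%SET nonzero.
have <- : #|T| = (p.+1 * p ^ M)%N.
  rewrite cardsX finset.cardsT card_ord cardsE card_ffun_on card_ord.
  by rewrite cardC1 card_ord.
apply/subset_leq_card/fintype.subsetP => _ /imsetP[q qS ->].
rewrite inE /= !inE /=; apply/ffun_onP => i.
by rewrite ffunE inE /= subr_eq0 eq_sym Sproper.
Qed.

(** The entropy is at most the rate of the segment [1, a, .., a^M] for every
    [M], and [d / M.+1] is what the free choice of the first colour costs. *)
Lemma htop_coloring_le (R : realType) N p : (2 <= N)%N -> (0 < p)%N ->
  htop R (graph_coloring N p.+1) <= ln p%:R.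
Proof.
move=> N_ge2 p0; have N0 : (0 < N)%N by exact: ltnW.
set h := htop _ _.
pose d : R := ln p.+1%:R - ln p%:R.
have h_le M : h <= ln p%:R + d * M.+1%:R^-1.
  pose e (i : 'I_M.+1) : BS N := box N i 0.
  have e_inj : injective e.
    by move=> i j /(box_inj N0)[ij _]; exact: val_inj.
  pose F : {fset BS N} := [fset e i | i in [pred _ : 'I_M.+1 | true]]%fset.
  have Fe : F =i codom e.
    by move=> g; apply/imfsetP/codomP => [[i _ ->]|[i ->]]; exists i.
  have F0 : F != fset0%fset.
    by apply/fset0Pn; exists (e ord0); rewrite Fe codom_f.
  apply: le_trans (htop_le_rate R _ N_ge2 F0) _.
  rewrite /rate (card_fset_codom e_inj Fe) card_ord ler_pdivrMr ?ltr0n//.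
  have -> : (ln p%:R + d * M.+1%:R^-1) * M.+1%:R = ln (p.+1 * p ^ M)%:R.
    rewrite natrM natrX lnM ?posrE ?exprn_gt0 ?ltr0n// lnXn ?ltr0n//.
    rewrite mulrDl -mulrA mulVf ?pnatr_eq0// mulr1 /d -[in LHS]natr1 -mulr_natr.
    by ring.
  have [->|k0] := posnP #|patterns (graph_coloring N p.+1) F|.
    by rewrite ln0// ln_nat_ge0.
  rewrite ler_ln ?posrE ?ltr0n ?muln_gt0 ?expn_gt0 ?p0//.
  rewrite ler_nat (card_patterns_image _ Fe); apply: card_proper_paths => q.
  rewrite inE => /asboolP[x Xx qx] i; rewrite !qx.
  apply/eqP; have [+ _] := Xx (e (widen_ord (leqnSn M) i)).
  by rewrite /e box_a expn0 addn1 /= /bump leq0n add1n.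
have lim_h : ((fun M => ln p%:R + d * M.+1%:R^-1)
    @ \oo --> (ln p%:R + d * 0 : R))%classic.
  apply: cvgD; first exact: cvg_cst.
  by apply: cvgM; [exact: cvg_cst|exact: cvg_harmonic].
rewrite mulr0 addr0 in lim_h; apply: (cvgr_to_ge lim_h).
by near=> M; exact: h_le.
Unshelve. all: by end_near.
Qed.

(** * Three colours: independent switches *)

Section FlexibleSites.
Context (R : realType) (N : nat).
Hypothesis N_ge2 : (2 <= N)%N.
Let X := graph_coloring N 3.

(** Two adjacent sites cannot both be flexible, since the neighbours of a
    flexible site have colour 0. *)
Definition flexible (c : BS N -> 'I_3) (g : BS N) : bool :=
  [&& c g != 0, c (g * BSa N)%g == 0, c (g * (BSa N)^-1)%g == 0,
      c (g * BSb N)%g == 0 & c (g * (BSb N)^-1)%g == 0].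

(** Each flexible site can be recoloured with 1 or -1 regardless of the others;
    [recolor B] uses 1 on the sites of [B]. *)
Lemma card_patterns_flexible c (F : {fset BS N}) : X c ->
  (2 ^ #|[set g : F | flexible c (val g)]%SET| <= #|patterns X F|)%N.
Proof.
move=> Xc; set D := [set g : F | _]%SET; rewrite -card_powerset.
pose recolor (B : {set F}) (g : BS N) : 'I_3 :=
  if flexible c g
  then (if insub g is Some h then if h \in B then 1 else -1 else 1)
  else c g.
have flexible_color B g : flexible c g -> recolor B g != 0.
  by move=> fg; rewrite /recolor fg; case: insub => [h|//]; case: ifP.
have rigid B g : c g = 0 -> recolor B g = 0.
  by move=> cg; rewrite /recolor /flexible cg eqxx.
have Xrecolor B : X (recolor B).
  move=> g; split=> /eqP.
    have [fg|fg] := boolP (flexible c g).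
      have /and5P[_ /eqP ga _ _ _] := fg.
      by rewrite (rigid B _ ga); apply/negP/flexible_color.
    have [fga|fga] := boolP (flexible c (g * BSa N)%g).
      have /and5P[_ _ /eqP] := fga; rewrite mulgK => cg _ _.
      by rewrite (rigid B _ cg) eq_sym; apply/negP/flexible_color.
    by rewrite /recolor (negbTE fg) (negbTE fga) => /eqP; exact: (Xc g).1.
  have [fg|fg] := boolP (flexible c g).
    have /and5P[_ _ _ /eqP gb _] := fg.
    by rewrite (rigid B _ gb); apply/negP/flexible_color.
  have [fgb|fgb] := boolP (flexible c (g * BSb N)%g).
    have /and5P[_ _ _ _ /eqP] := fgb; rewrite mulgK => cg.
    by rewrite (rigid B _ cg) eq_sym; apply/negP/flexible_color.
  by rewrite /recolor (negbTE fg) (negbTE fgb) => /eqP; exact: (Xc g).2.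
pose phi (B : {set F}) : {ffun F -> 'I_3} := [ffun g => recolor B (val g)].
have phiE B h : h \in D -> (phi B h == 1) = (h \in B).
  by rewrite inE /phi ffunE /recolor => ->; rewrite valK; case: ifP.
rewrite -(card_in_imset (f := phi)) => [|B B'].
  apply/subset_leq_card/fintype.subsetP => _ /imsetP[B _ ->].
  by rewrite inE; apply/asboolP; exists (recolor B) => // g; rewrite ffunE.
rewrite !powersetE => /fintype.subsetP BD /fintype.subsetP BD' phiB.
apply/setP => h; have [hD|hD] := boolP (h \in D).
  by rewrite -(phiE B)// -(phiE B')// phiB.
by rewrite (contraNF (BD h) hD) (contraNF (BD' h) hD).
Qed.

(** Multiply the bounds of [card_patterns_flexible] over [J]: each site of [F]
    contributes a factor 2 at least once. *)
Lemma htop_flexible (J : finType) (c : J -> BS N -> 'I_3) :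
  (forall j, X (c j)) -> (forall g, exists j, flexible (c j) g) ->
  ln 2 / #|J|%:R <= htop R X.
Proof.
move=> Xc cover; apply: htop_ge => // F F0.
have J0 : (0 < #|J|)%N.
  by have [j _] := cover 1%g; apply/card_gt0P; exists j.
pose D j := [set g : F | flexible (c j) (val g)]%SET.
have F_le : (#|` F| <= \sum_j #|D j|)%N.
  rewrite cardfE -sum1_card.
  under [leqRHS]eq_bigr => j _ do rewrite -sum1_card big_mkcond/=.
  rewrite exchange_big/=; apply: leq_sum => g _.
  by have [j jg] := cover (val g); rewrite (bigD1 j)//= inE jg.
have pow_le : (2 ^ #|` F| <= #|patterns X F| ^ #|J|)%N.
  apply: leq_trans (leq_pexp2l _ F_le) _ => //.
  rewrite expn_sum -prod_nat_const; apply: leq_prod => j _.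
  exact: card_patterns_flexible.
have [j0 _] := cover 1%g.
have cnt0 : (0 < #|patterns X F|)%N.
  by apply: leq_trans (card_patterns_flexible F (Xc j0)); rewrite expn_gt0.
rewrite /rate ler_pdivrMr ?ltr0n// mulrAC ler_pdivlMr ?ltr0n ?cardfs_gt0//.
rewrite !mulr_natr -!lnXn ?ltr0n// ler_ln ?posrE ?exprn_gt0 ?ltr0n//.
by rewrite -!natrX ler_nat.
Qed.

End FlexibleSites.

(** When [N] is odd both generators change [parity], so the Cayley graph is
    bipartite: one class receives colour 0 and the whole other class is
    flexible. *)
Lemma htop_coloring3_odd (R : realType) N : (2 <= N)%N -> odd N ->
  ln 2 / 2 <= htop R (graph_coloring N 3).
Proof.
move=> N_ge2 oddN.
have N1 : (N%:R : 'Z_2) = 1.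
  by rewrite Zp_nat; apply: val_inj; rewrite /= modn2 oddN.
have uN : (N%:R : 'Z_2) \is a GRing.unit by rewrite N1 unitr1.
pose parity (g : BS N) : 'Z_2 :=
  (coord (0, 0) g).1 + (coord (K := 'Z_2) (0, 0) g).2%:~R.
have pa g : parity (g * BSa N)%g = parity g + 1.
  by rewrite /parity coordM// coord_a//= N1 exp1rz addrAC.
have pb g : parity (g * BSb N)%g = parity g + 1.
  by rewrite /parity coordM// coord_b//= rmorphD/= addrA.
have paV g : parity (g * (BSa N)^-1)%g = parity g - 1.
  by rewrite -[in RHS](mulgVK (BSa N) g) pa addrK.
have pbV g : parity (g * (BSb N)^-1)%g = parity g - 1.
  by rewrite -[in RHS](mulgVK (BSb N) g) pb addrK.
pose c (j : 'Z_2) (g : BS N) : 'I_3 := if parity g == j then 1 else 0.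
have neq1 (y : 'Z_2) : (y + 1 == y) = false.
  by case: y => -[|[|//]].
have neqV1 (y : 'Z_2) : (y - 1 == y) = false.
  by case: y => -[|[|//]].
suff : ln 2 / #|{: 'Z_2}|%:R <= htop R (graph_coloring N 3) by rewrite card_ord.
apply: (@htop_flexible R N N_ge2 _ c) => [j g|g].
  rewrite /c pa pb; suff : (if parity g == j then 1 else 0 : 'I_3) <>
    (if parity g + 1 == j then 1 else 0) by split.
  by case: (parity g) j => -[|[|//]] ? [[|[|//]] ?].
by exists (parity g); rewrite /flexible /c pa paV pb pbV eqxx /= neq1 neqV1.
Qed.

(** A 3-colouring of the generalised Petersen graph [G(N^2 + 1, N)]: the outer
    vertices are [x ~ x + 1] and the inner ones [x ~ x + N], modulo [N^2 + 1],
    with a spoke from each outer [x] to the inner [x]. The outer cycle is odd,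
    and its colours alternate up to the exceptional vertex [N^2]; the inner
    colours alternate with the quotient [x / N]. *)
Definition petersen_color (N : nat) (inner : bool) (x : nat) : 'I_3 :=
  if inner then (if odd (x %/ N) then -1 else if odd x then 0 else 1)
  else (if x == (N ^ 2)%N then -1 else if odd x then 1 else 0).

Definition layer (t : int) : bool := odd `|t|%N.

Lemma layerS t : layer (t + 1) = ~~ layer t.
Proof. by rewrite /layer; lia. Qed.

Lemma layerB t : layer (t - 1) = ~~ layer t.
Proof. by rewrite /layer; lia. Qed.

Section EvenBase.
Variable N : nat.
Hypothesis N_ge2 : (2 <= N)%N.
Hypothesis evenN : ~~ odd N.
Let M := (N ^ 2).+1.
Let N_gt0 : (0 < N)%N. Proof. exact: ltnW. Qed.

Lemma odd_sqr_pred : odd (N ^ 2).-1.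
Proof.
have : odd (N ^ 2).-1.+1 = false.
  by rewrite prednK ?expn_gt0 ?N_gt0// oddX (negbTE evenN).
by rewrite oddS => /negbFE.
Qed.

Lemma petersen_outer x : (x < M)%N ->
  petersen_color N false x != petersen_color N false ((x + 1) %% M).
Proof.
rewrite ltnS leq_eqVlt => /orP[/eqP->|x_lt].
  rewrite addn1 modnn /petersen_color eqxx.
  have -> : (0 == N ^ 2)%N = false by rewrite eq_sym expn_eq0 (gtn_eqF N_gt0).
  by [].
rewrite addn1 modn_small// /petersen_color (ltn_eqF x_lt).
case: (x.+1 =P (N ^ 2)%N) => [xN|_]; last by rewrite oddS; case: (odd x).
by have -> : odd x by rewrite -[x]/(x.+1.-1) xN odd_sqr_pred.
Qed.

(** Adding [N] increases the quotient [x / N] by one, except that from quotient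
    [N - 1], which is odd, it may wrap around to quotient 0, and that [N^2] goes
    to [N - 1]. *)
Lemma petersen_inner x : (x < M)%N ->
  petersen_color N true x != petersen_color N true ((x + N) %% M).
Proof.
rewrite ltnS => x_le; rewrite /petersen_color.
have small y : (if odd y then 0 else 1 : 'I_3) != -1 by case: (odd y).
have [xN|xN] := leqP (x + N)%N (N ^ 2)%N.
  rewrite modn_small// divnDr// divnn N_gt0 addn1 oddS.
  by case: (odd (x %/ N)) => //=; rewrite eq_sym.
have [->|x_lt] : x = (N ^ 2)%N \/ (x < N ^ 2)%N.
  by move: x_le; rewrite leq_eqVlt => /orP[/eqP|]; [left|right].
  have -> : (N ^ 2 + N = N.-1 + M)%N by rewrite addnS -addSn prednK// addnC.
  rewrite modnDr modn_small; last first.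
    by rewrite ltnS (leq_trans (leq_pred _))// -{1}(expn1 N) leq_exp2l.
  rewrite (@divn_small N.-1) ?prednK// -mulnn mulnK//.
  rewrite (negbTE evenN) oddM (negbTE evenN) /=.
  have : odd N.-1.+1 = false by rewrite prednK// (negbTE evenN).
  by rewrite oddS => /negbFE ->.
have qE : (x %/ N)%N = N.-1.
  apply/eqP; rewrite eqn_leq -ltnS prednK// ltn_divLR// mulnn x_lt /=.
  rewrite leq_divRL// -(leq_add2r N) -mulSnr prednK// mulnn; exact: ltnW.
have odd_q : odd N.-1.
  have : odd N.-1.+1 = false by rewrite prednK// (negbTE evenN).
  by rewrite oddS => /negbFE ->.
have yM : (x + N = (x + N - M) + M)%N by rewrite subnK.
have y_lt : (x + N - M < N)%N.
  by rewrite ltn_subLR// ltn_add2r ltnS ltnW.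
rewrite yM modnDr modn_small; last first.
  by rewrite (ltn_trans y_lt)// ltnS -{1}(expn1 N) leq_exp2l.
by rewrite qE odd_q divn_small//= eq_sym.
Qed.

Lemma petersen_spoke x : petersen_color N false x != petersen_color N true x.
Proof.
rewrite /petersen_color; case: (x =P (N ^ 2)%N) => [->|_]; last first.
  by case: (odd (x %/ N)); case: (odd x).
by rewrite -mulnn mulnK// (negbTE evenN) oddM (negbTE evenN).
Qed.

Lemma Zp_sqr_pred : (N%:R : 'Z_M) * N%:R = -1.
Proof.
apply/eqP; rewrite -addr_eq0 -natrM mulnn natr1.
by rewrite -/M pchar_Zp// ltnS expn_gt0 N_gt0.
Qed.

Let u : 'Z_M := N%:R.
Let uu : u * u = -1. Proof. exact: Zp_sqr_pred. Qed.
Let M_gt1 : (1 < M)%N. Proof. by rewrite ltnS expn_gt0 N_gt0. Qed.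

Lemma unit_Zp_sqr_pred : u \is a GRing.unit.
Proof. by apply/unitrPr; exists (- u); rewrite mulrN uu opprK. Qed.

Let uV : u^-1 = - u.
Proof.
apply: (mulrI unit_Zp_sqr_pred).
by rewrite mulrV ?unit_Zp_sqr_pred// mulrN uu opprK.
Qed.

(** Since [N^2 = -1], the horizontal edges have step [1] or [-1] in even layers
    and [u] or [-u] in odd ones. Reducing [t] modulo 2 thus maps the Cayley
    graph to the generalised Petersen graph, odd layers to inner vertices. *)
Lemma step_layer t :
  exists e : bool, u ^ t = (-1) ^+ e * (if layer t then u else 1).
Proof.
elim/int_ind: t => [|n [e IH]|n [e IH]].
- by exists false; rewrite expr0z !mulr1.
- rewrite intS addrC exprzDr ?unit_Zp_sqr_pred// IH expr1z layerS.
  case: ifP => _ /=; last by exists e; rewrite mulr1.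
  by exists (~~ e); rewrite -mulrA uu signrN mulrN mulNr mulr1.
- rewrite intS opprD addrC exprzDr ?unit_Zp_sqr_pred// IH exprN1 layerB uV.
  case: ifP => _ /=; first by exists e; rewrite -mulrA mulrN uu opprK.
  by exists (~~ e); rewrite mulr1 signrN mulrN mulNr.
Qed.

Definition petersen (inner : bool) (x : 'Z_M) : 'I_3 :=
  petersen_color N inner x.

Lemma petersen_step inner x :
  petersen inner x != petersen inner (x + (if inner then u else 1)).
Proof.
have xM : (x < M)%N by rewrite -[X in (_ < X)%N](Zp_cast M_gt1).
have valD n : nat_of_ord (x + n%:R) = ((x + n) %% M)%N.
  by rewrite -{1}(natr_Zp x) -natrD val_Zp_nat.
rewrite /petersen; case: inner; first by rewrite valD petersen_inner.
by rewrite -[1]/(1%:R) valD petersen_outer.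
Qed.

Definition petersen_cover (j : 'Z_M * bool) (g : BS N) : 'I_3 :=
  let v := coord (j.1, (j.2 : nat)%:Z) g in petersen (layer v.2) v.1.

Lemma petersen_cover_coloring j : graph_coloring N 3 (petersen_cover j).
Proof.
have uN := unit_Zp_sqr_pred.
move=> g; rewrite /petersen_cover !coordM// coord_a// coord_b//.
case: (coord _ g) => x t /=; split; apply/eqP.
  have [e ->] := step_layer t.
  case: e => /=; last by rewrite mul1r petersen_step.
  set s := (if layer t then u else 1).
  by rewrite mulN1r eq_sym -{2}(subrK s x) petersen_step.
rewrite layerS; case: (layer t) => /=; last exact: petersen_spoke.
by rewrite eq_sym petersen_spoke.
Qed.

Lemma petersen_flexible (x : 'Z_M) : x = 1 ->
  [/\ petersen false x != 0, petersen false (x + 1) = 0,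
      petersen false (x - 1) = 0 & petersen true x = 0].
Proof.
move=> ->; rewrite subrr.
have N2 : (4 <= N ^ 2)%N by rewrite (leq_exp2r 2 N (isT : 0 < 2)%N).
have val1 : nat_of_ord (1 : 'Z_M) = 1%N by [].
have val2 : nat_of_ord (1 + 1 : 'Z_M) = 2%N.
  by rewrite -[1 + 1]/(2%:R) val_Zp_nat// modn_small// ltnS (leq_trans _ N2).
rewrite /petersen /petersen_color val1 val2 /=.
rewrite (ltn_eqF (leq_trans _ N2 : 1 < N ^ 2)%N)//.
rewrite (ltn_eqF (leq_trans _ N2 : 2 < N ^ 2)%N)//.
by rewrite (ltn_eqF (leq_trans _ N2 : 0 < N ^ 2)%N)// divn_small.
Qed.

(** The translates move any given site onto the flexible outer vertex 1: the
    second index corrects the parity of the layer, the first one the position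
    within it. *)
Lemma petersen_cover_flexible g : exists j, flexible (petersen_cover j) g.
Proof.
have uN := unit_Zp_sqr_pred.
pose y := coord (K := 'Z_M) (0, 0) g.
pose e := layer y.2.
exists (1 - u ^ (e : nat)%:Z * y.1, e).
rewrite /flexible /petersen_cover !coordM// coord_base// -/y /= subrK.
rewrite coord_a// coord_aV// coord_b// coord_bV//=.
set t := (_ + y.2); have t_even : layer t = false by rewrite /t /e /layer; lia.
have [f0 f1 f_1 f_in] := petersen_flexible (erefl (1 : 'Z_M)).
rewrite layerS layerB t_even f0 f_in.
have [sgn ->] := step_layer t; rewrite t_even mulr1.
by case: sgn; rewrite ?expr1 ?expr0 ?opprK f1 f_1.
Qed.

Lemma htop_coloring3_even (R : realType) :
  ln 2 / (2 * (N%:R ^+ 2 + 1)) <= htop R (graph_coloring N 3).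
Proof.
have <- : #|{: 'Z_M * bool}|%:R = 2 * (N%:R ^+ 2 + 1) :> R.
  rewrite card_prod card_bool card_ord Zp_cast// natrM mulrC.
  by congr (_ * _); rewrite -natr1 natrX.
exact: htop_flexible petersen_cover_coloring petersen_cover_flexible.
Qed.

End EvenBase.

(** * Greedy colourings *)

(** Recursion over the integers outwards from 0: each entry is computed from its
    neighbour nearer to 0, and the one at 0 from [z]. It is used twice, along a
    line of a layer and from layer to layer. *)
Section Zigzag.
Context (T : Type) (step : int -> T -> T) (z : T).

Fixpoint zig_up (n : nat) : T :=
  step n%:Z (if n is m.+1 then zig_up m else z).

Fixpoint zig_down (n : nat) : T :=
  if n is m.+1 then step (- n%:Z) (zig_down m) else zig_up 0.

Definition zigzag (t : int) : T :=
  match t with Posz n => zig_up n | Negz n => zig_down n.+1 end.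

Lemma zigzag_step t : exists p, zigzag t = step t p.
Proof.
case: t => [[|n]|n]; [by exists z|by exists (zig_up n)|].
by exists (zig_down n); rewrite NegzE.
Qed.

Lemma zigzag_rel (r : T -> T -> Prop) : (forall p q, r p q -> r q p) ->
  (forall t p, r p (step t p)) -> forall t, r (zigzag t) (zigzag (t + 1)).
Proof.
move=> r_sym r_step [n|n]; first by rewrite -PoszD addn1 /=; exact: r_step.
have -> : zigzag (Negz n + 1) = zig_down n.
  by rewrite NegzE -addn1 PoszD opprD subrK; case: n.
exact/r_sym/r_step.
Qed.

End Zigzag.

Section GreedyColoring.
Context (k : nat).

Definition free_color (a b : 'I_k.+3) (c : 'I_k.+1) : 'I_k.+3 :=
  nth ord0 (enum (~: [set a; b])%SET) c.

Lemma free_color_size (a b : 'I_k.+3) (c : 'I_k.+1) :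
  (c < size (enum (~: [set a; b])%SET))%N.
Proof.
rewrite -cardE; apply: leq_trans (ltn_ord c) _.
have := cardsC [set a; b]%SET; rewrite card_ord => cardab.
rewrite -(leq_add2l #|[set a; b]%SET|) cardab cards2.
by case: (a != b).
Qed.

Lemma free_colorP a b c : free_color a b c != a /\ free_color a b c != b.
Proof.
have := mem_nth ord0 (free_color_size a b c).
by rewrite mem_enum !inE negb_or => /andP.
Qed.

Lemma free_color_inj a b : injective (free_color a b).
Proof.
move=> c d /eqP; rewrite nth_uniq ?free_color_size ?enum_uniq// => /eqP.
exact: val_inj.
Qed.

(** Every line [x + s Z] is coloured outwards from its representative [y] in
    [[0, s)]. A site avoids the colour given by [f], which will be that of the
    adjacent layer, and that of its predecessor on the line; [c] selects one of
    the remaining colours. *)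
Definition color_line (s : rat) (c : rat -> 'I_k.+1) (f : rat -> 'I_k.+3)
    (x : rat) : 'I_k.+3 :=
  let q := Num.floor (x / s) in
  let y := x - q%:~R * s in
  zigzag (fun j p => free_color (f (y + j%:~R * s)) p (c (y + j%:~R * s)))
    ord0 q.

Section Line.
Context (s : rat) (c : rat -> 'I_k.+1) (f : rat -> 'I_k.+3).
Hypothesis s_gt0 : 0 < s.

Lemma color_line_avoid x : color_line s c f x != f x.
Proof.
rewrite /color_line; set step := (X in zigzag X _ _).
have [p ->] := zigzag_step step ord0 (Num.floor (x / s)).
by rewrite /step subrK; exact: (free_colorP _ _ _).1.
Qed.

Lemma floor_line_step x : Num.floor ((x + s) / s) = Num.floor (x / s) + 1.
Proof. by rewrite mulrDl divff ?gt_eqF// floorDrz// floor1. Qed.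

Lemma line_base_step x : x + s - (Num.floor ((x + s) / s))%:~R * s =
  x - (Num.floor (x / s))%:~R * s.
Proof.
by rewrite floor_line_step intrD mulrDl mul1r opprD addrACA subrr addr0.
Qed.

Lemma color_line_proper x : color_line s c f x != color_line s c f (x + s).
Proof.
rewrite /color_line line_base_step floor_line_step.
apply: (@zigzag_rel _ _ _ (fun p q => p != q)) => [p q|t p]; rewrite eq_sym//.
exact: (free_colorP _ _ _).2.
Qed.

Lemma color_line_first x : 0 <= x < s ->
  color_line s c f x = free_color (f x) ord0 (c x).
Proof.
move=> /andP[x0 xs]; rewrite /color_line.
have -> : Num.floor (x / s) = 0.
  apply: floor_def.
  by rewrite add0r divr_ge0 ?(ltW s_gt0)//= ltr_pdivrMr// mul1r.
by rewrite /= !mul0r addr0 subr0.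
Qed.

Lemma color_line_next x : 0 <= x ->
  color_line s c f (x + s) =
  free_color (f (x + s)) (color_line s c f x) (c (x + s)).
Proof.
move=> x0; have yE := line_base_step x.
have yK : x - (Num.floor (x / s))%:~R * s + (Num.floor (x / s) + 1)%:~R * s
    = x + s.
  by rewrite -yE -floor_line_step subrK.
rewrite /color_line yE floor_line_step.
have : 0 <= Num.floor (x / s) by rewrite floor_ge0 divr_ge0// ltW.
case: (Num.floor (x / s)) yK => // n; rewrite -PoszD addn1 => yK _ /=.
by rewrite yK.
Qed.

End Line.

Section Sheet.
Variable N : nat.
Hypothesis N_ge2 : (2 <= N)%N.
Let N_gt0 : (0 < N)%N. Proof. exact: ltnW. Qed.
Let Npow_gt0 (t : int) : 0 < (N%:R : rat) ^ t.
Proof. by rewrite exprz_gt0// ltr0n. Qed.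

Definition sheet (c : int -> rat -> 'I_k.+1) : int -> rat -> 'I_k.+3 :=
  zigzag (fun t p => color_line (N%:R ^ t) (c t) p) (fun=> ord0).

Lemma sheet_horizontal c t x : sheet c t x != sheet c t (x + N%:R ^ t).
Proof.
rewrite /sheet; set step := (X in zigzag X _ _).
have [p ->] := zigzag_step step (fun=> ord0) t.
exact: color_line_proper.
Qed.

Lemma sheet_vertical c t x : sheet c t x != sheet c (t + 1) x.
Proof.
move: x; rewrite /sheet.
apply: (@zigzag_rel _ _ _ (fun p q => forall x, p x != q x))
  => [p q pq x|t' p x].
  by rewrite eq_sym.
by rewrite eq_sym color_line_avoid.
Qed.

(** The earlier neighbours of a site of a rectangle lie in the same rectangle,
    or do not exist and are replaced by the dummy colour [ord0]. *)
Lemma sheet_box c (i j : nat) : sheet c i j%:R =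
  free_color (if i is i'.+1 then sheet c i' j%:R else ord0)
             (if (N ^ i <= j)%N then sheet c i (j - N ^ i)%N%:R else ord0)
             (c i j%:R).
Proof.
pose f : rat -> 'I_k.+3 := if i is i'.+1 then sheet c i' else fun=> ord0.
have sheetE x : sheet c i x = color_line (N%:R ^ i) (c i) f x.
  by rewrite /f; case: (i).
have -> : (if i is i'.+1 then sheet c i' j%:R else ord0) = f j%:R.
  by rewrite /f; case: (i).
have powE : (N%:R : rat) ^ i = (N ^ i)%:R by rewrite natrX.
rewrite !sheetE; case: ifP => [ij|/negbT]; last first.
  rewrite -ltnNge => ji; apply: (color_line_first _ _ (Npow_gt0 i)).
  by rewrite ler0n powE ltr_nat.
by rewrite -{1 2 4}(subnK ij) natrD -powE (color_line_next _ _ (Npow_gt0 i)).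
Qed.

Definition sheet_coloring c (g : BS N) : 'I_k.+3 :=
  let v := coord (0, 0) g in sheet c v.2 v.1.

Lemma sheet_coloringP c : graph_coloring N k.+3 (sheet_coloring c).
Proof.
have uN := unit_rat N_gt0.
move=> g; rewrite /sheet_coloring !coordM// coord_a// coord_b//.
case: (coord _ g) => x t /=; split; apply/eqP; first exact: sheet_horizontal.
exact: sheet_vertical.
Qed.

(** The colours on the rectangle determine the choices made there: by
    [sheet_box] the colour of a site and those of its earlier neighbours give
    back the choice at that site. *)
Lemma card_patterns_rect m :
  (k.+1 ^ #|` rect N m| <= #|patterns (graph_coloring N k.+3) (rect N m)|)%N.
Proof.
rewrite (card_patterns_image _ (@rect_codom N m)) card_rect//.
set T := ('I_(N ^ m) * 'I_m)%type.
pose choices (w : {ffun T -> 'I_k.+1}) (t : int) (x : rat) : 'I_k.+1 :=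
  if [pick p : T | (p.2%:Z == t) && (p.1%:R == x)] is Some p then w p else ord0.
have choicesE w (p : T) : choices w p.2 p.1%:R = w p.
  rewrite /choices; case: pickP => [[j i] /=|/(_ p)]; last by rewrite !eqxx.
  case: p => j' i' /=; rewrite eqr_nat.
  by move=> /andP[/eqP[] /val_inj -> /eqP /val_inj ->].
pose phi (w : {ffun T -> 'I_k.+1}) : {ffun T -> 'I_k.+3} :=
  [ffun p : T => sheet (choices w) p.2 p.1%:R].
have phi_inj : injective phi.
  move=> w w' /ffunP ww'.
  have eq_sheet (i j : nat) : (i < m)%N -> (j < N ^ m)%N ->
      sheet (choices w) i j%:R = sheet (choices w') i j%:R.
    by move=> im jm; have := ww' (Ordinal jm, Ordinal im); rewrite !ffunE.
  apply/ffunP => -[j i]; have := eq_sheet i j (ltn_ord i) (ltn_ord j).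
  rewrite (sheet_box (choices w)) (sheet_box (choices w')).
  rewrite (choicesE w (j, i)) (choicesE w' (j, i)).
  have <- : (if (N ^ i <= j)%N
             then sheet (choices w) i (j - N ^ i)%N%:R else ord0)
      = (if (N ^ i <= j)%N
         then sheet (choices w') i (j - N ^ i)%N%:R else ord0).
    case: ifP => // _; apply: eq_sheet => //.
    exact: leq_ltn_trans (leq_subr _ _) _.
  have <- : (if i : nat is i'.+1 then sheet (choices w) i' j%:R else ord0)
      = (if i : nat is i'.+1 then sheet (choices w') i' j%:R else ord0).
    by case: i => -[|i'] im //=; apply: eq_sheet => //; exact: ltnW.
  exact: free_color_inj.
have -> : (k.+1 ^ (N ^ m * m))%N = #|{: {ffun T -> 'I_k.+1}}|.
  by rewrite card_ffun card_ord card_prod !card_ord.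
rewrite -(card_imset predT phi_inj); apply/subset_leq_card/fintype.subsetP.
move=> _ /imsetP[w _ ->]; rewrite inE; apply/asboolP.
exists (sheet_coloring (choices w)); first exact: sheet_coloringP.
by move=> p; rewrite ffunE /sheet_coloring coord_box.
Qed.

Lemma htop_coloring_ge (R : realType) :
  ln k.+1%:R <= htop R (graph_coloring N k.+3).
Proof.
apply: htop_ge_rect => // m.
have rect0 : (0 < #|` rect N m.+1|)%N.
  by rewrite card_rect// muln_gt0 expn_gt0 N_gt0.
have pow_le := card_patterns_rect m.+1.
rewrite /rate ler_pdivlMr ?ltr0n// mulr_natr -lnXn ?ltr0n// -natrX.
rewrite ler_ln ?posrE ?ltr0n ?expn_gt0// ?ler_nat//.
by apply: leq_trans pow_le; rewrite expn_gt0.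
Qed.

End Sheet.
End GreedyColoring.

(** * The entropy bounds *)

Unset Implicit Arguments.

Theorem theorem1p3 (R : realType) (N : nat) (hN : (2 <= N)%N) :
  (forall n : nat, (3 <= n)%N ->
     ln (n%:R - 2 : R) <= htop R (graph_coloring N n) <= ln (n%:R - 1 : R)) /\
  0 < htop R (graph_coloring N 3) /\
  (odd N -> ln (2 : R) / 2 <= htop R (graph_coloring N 3)) /\
  (~~ odd N ->
     ln (2 : R) / (2 * (N%:R ^+ 2 + 1)) <= htop R (graph_coloring N 3)).
Proof.
have ln2_gt0 : 0 < ln (2 : R) by rewrite ln_gt0// ltr1n.
split; last split; last split.
- move=> [|[|[|k]]]// _.
  have -> : k.+3%:R - 2 = k.+1%:R :> R by rewrite -[k.+3]addn2 natrD addrK.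
  have -> : k.+3%:R - 1 = k.+2%:R :> R by rewrite -[k.+3]addn1 natrD addrK.
  by rewrite htop_coloring_ge// htop_coloring_le.
- have [oddN|evenN] := boolP (odd N).
    by apply: lt_le_trans (htop_coloring3_odd R hN oddN); rewrite divr_gt0.
  apply: lt_le_trans (htop_coloring3_even hN evenN R).
  by rewrite divr_gt0// mulr_gt0// ltr_wpDl// exprn_ge0.
- exact: htop_coloring3_odd.
- by move=> evenN; exact: htop_coloring3_even.
Qed.
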